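(* Let $\Omega\subseteq\mathbb{R}^n$ be closed and nonempty, and let $\bar\omega\in\Omega$. (i) The set $\Omega$ is subsmooth at $\bar\omega$ if and only if $\Omega$ is Clarke super-regular at $\bar\omega$. (ii) The set $\Omega$ is semi-subsmooth at $\bar\omega$ if and only if for each $\varepsilon>0$ there is a $\delta>0$ such that both of the following hold: for every $\bar\omega^*\in N^{\mathrm C}_\Omega(\bar\omega)$, $$\langle\bar\omega^*,\omega-\bar\omega\rangle\le\varepsilon\|\bar\omega^*\|\,\|\omega-\bar\omega\|\qquad\text{for all }\omega\in\Omega\cap\mathbb{B}_\delta(\bar\omega);$$ and for all $\omega\in\Omega\cap\mathbb{B}_\delta(\bar\omega)$ and all $\omega^*\in N^{\mathrm C}_\Omega(\omega)$, $$\langle\omega^*,\bar\omega-\omega\rangle\le\varepsilon\|\omega^*\|\,\|\bar\omega-\omega\|.$$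
   Context: $\mathbb{B}_r(x)$ is the closed Euclidean ball of radius $r$ centered at $x$. Normal cones. For $\Omega\subseteq\mathbb{R}^n$ and $\omega\in\Omega$: - The Fréchet normal cone $\hat N_\Omega(\omega)$ is the set of $w\in\mathbb{R}^n$ such that for every $\varepsilon>0$ there is $\delta>0$ with $\langle w,z-\omega\rangle\le\varepsilon\|z-\omega\|$ for all $z\in\Omega\cap\mathbb{B}_\delta(\omega)$. - The limiting normal cone $N_\Omega(\omega)$ is the set of $w$ for which there exist $\omega_k\to\omega$ with $\omega_k\in\Omega$ and $w_k\in\hat N_\Omega(\omega_k)$ with $w_k\to w$. - The Clarke normal cone is $N^{\mathrm C}_\Omega(\omega)=\operatorname{cl}\operatorname{conv}N_\Omega(\omega)$. All normal cones are empty at points not in $\Omega$. For $r>0$, the $r$-truncated Clarke normal cone is $N^{r\mathrm C}_\Omega(\omega)=N^{\mathrm C}_\Omega(\omega)\cap\mathbb{B}_r(0)$. Clarke super-regularity. $\Omega$ is Clarke super-regular at $\bar\omega\in\Omega$ if it is locally closed at $\bar\omega$ and for every $\varepsilon>0$ there exists $\delta>0$ such that for every $\hat\omega\in\Omega\cap\mathbb{B}_\delta(\bar\omega)$ and $\hat\omega^*\in N^{\mathrm C}_\Omega(\hat\omega)$ one has $\langle\hat\omega^*,\omega-\hat\omega\rangle\le\varepsilon\|\hat\omega^*\|\,\|\omega-\hat\omega\|$ for all $\omega\in\Omega\cap\mathbb{B}_\delta(\bar\omega)$. Subsmoothness. A closed set $\Omega$ is subsmooth at $\bar\omega\in\Omega$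 if for every $r>0$ and $\varepsilon>0$ there exists $\delta>0$ such that for all $\omega_1,\omega_2\in\mathbb{B}_\delta(\bar\omega)\cap\Omega$, all $\omega_1^*\in N^{r\mathrm C}_\Omega(\omega_1)$ and all $\omega_2^*\in N^{r\mathrm C}_\Omega(\omega_2)$ one has $\langle\omega_1^*-\omega_2^*,\omega_1-\omega_2\rangle\ge-\varepsilon\|\omega_1-\omega_2\|$. Semi-subsmoothness. A closed set $\Omega$ is semi-subsmooth at $\bar\omega\in\Omega$ if for every $r>0$ and $\varepsilon>0$ there exists $\delta>0$ such that for all $\omega\in\mathbb{B}_\delta(\bar\omega)\cap\Omega$, all $\omega^*\in N^{r\mathrm C}_\Omega(\omega)$ and all $\bar\omega^*\in N^{r\mathrm C}_\Omega(\bar\omega)$ one has $\langle\omega^*-\bar\omega^*,\omega-\bar\omega\rangle\ge-\varepsilon\|\omega-\bar\omega\|$. *)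

(* Defs.v *)
From HB Require Import structures.
From mathcomp Require Import all_boot all_order all_algebra.
From mathcomp Require Import all_classical all_reals all_analysis.
Set Implicit Arguments.
Unset Strict Implicit.
Unset Printing Implicit Defensive.
Import Order.TTheory GRing.Theory Num.Theory.
Import numFieldNormedType.Exports.
Local Open Scope classical_set_scope.
Local Open Scope ring_scope.

Section EuclideanSpace.
Context {R : realType} {n : nat}.
Implicit Types u v x : 'rV[R]_n.

Definition dotv u v : R := \sum_(i < n) u 0 i * v 0 i.

(* The library norm `|u| on 'rV[R]_n is the sup norm. It induces the same
   topology as enorm, so the library's closed, closure and cvg are used as is. *)
Definition enorm u : R := Num.sqrt (dotv u u).

Definition eball (r : R) x : set 'rV[R]_n := [set y | enorm (y - x) <= r].

Definition convex_hull (A : set 'rV[R]_n) : set 'rV[R]_n :=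
  smallest (fun C : set 'rV[R]_n =>
    convex_set (C : set (convex_lmodType 'rV[R]_n))) A.

End EuclideanSpace.

Section NormalCones.
Context {R : realType} {n : nat}.
Implicit Types (Omega : set 'rV[R]_n) (w : 'rV[R]_n).

(* The conjunct Omega w makes each cone empty at points outside Omega;
   clarke_normal inherits this, the closed convex hull of set0 being set0. *)
Definition frechet_normal Omega w : set 'rV[R]_n :=
  [set v | Omega w /\
    forall eps : R, 0 < eps -> exists2 delta : R, 0 < delta &
      forall z, (Omega `&` eball delta w) z ->
        dotv v (z - w) <= eps * enorm (z - w)].

Definition limiting_normal Omega w : set 'rV[R]_n :=
  [set v | Omega w /\
    exists wk vk : nat -> 'rV[R]_n,
      [/\ forall k, Omega (wk k),
          wk @ \oo --> w,
          forall k, frechet_normal Omega (wk k) (vk k) &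
          vk @ \oo --> v]].

Definition clarke_normal Omega w : set 'rV[R]_n :=
  closure (convex_hull (limiting_normal Omega w)).

Definition truncated_clarke_normal (r : R) Omega w : set 'rV[R]_n :=
  clarke_normal Omega w `&` eball r 0.

Definition locally_closed_at Omega w : Prop :=
  exists2 r : R, 0 < r & closed (Omega `&` eball r w).

Definition clarke_super_regular Omega w : Prop :=
  [/\ Omega w, locally_closed_at Omega w &
    forall eps : R, 0 < eps -> exists2 delta : R, 0 < delta &
      forall w1 v1, (Omega `&` eball delta w) w1 -> clarke_normal Omega w1 v1 ->
        forall w2, (Omega `&` eball delta w) w2 ->
          dotv v1 (w2 - w1) <= eps * enorm v1 * enorm (w2 - w1)].

Definition subsmooth Omega w : Prop :=
  [/\ closed Omega, Omega w &
    forall r eps : R, 0 < r -> 0 < eps -> exists2 delta : R, 0 < delta &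
      forall w1 w2, (eball delta w `&` Omega) w1 ->
        (eball delta w `&` Omega) w2 ->
        forall v1 v2, truncated_clarke_normal r Omega w1 v1 ->
          truncated_clarke_normal r Omega w2 v2 ->
          dotv (v1 - v2) (w1 - w2) >= - eps * enorm (w1 - w2)].

Definition semi_subsmooth Omega w : Prop :=
  [/\ closed Omega, Omega w &
    forall r eps : R, 0 < r -> 0 < eps -> exists2 delta : R, 0 < delta &
      forall w1, (eball delta w `&` Omega) w1 ->
        forall v1 v, truncated_clarke_normal r Omega w1 v1 ->
          truncated_clarke_normal r Omega w v ->
          dotv (v1 - v) (w1 - w) >= - eps * enorm (w1 - w)].

End NormalCones.

(* Main.v *)
Require Import Defs.
From HB Require Import structures.
From mathcomp Require Import all_boot all_order all_algebra.
From mathcomp Require Import all_classical all_reals all_analysis.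
From mathcomp Require Import ring lra.
Import Order.TTheory GRing.Theory Num.Theory.
Import numFieldNormedType.Exports.
Local Open Scope classical_set_scope.
Local Open Scope ring_scope.

(** Both equivalences compare, over a class of pairs of points of [Omega], a
    monotonicity inequality for truncated normals at both points with one-sided
    normal inequalities taken at each point separately. The comparison is
    carried out pair by pair.

    From one-sided to monotone: adding the inequalities at [w1] and at [w2]
    bounds the defect of monotonicity by [eps * (|v1| + |v2|)] times the
    distance, and [|v1|], [|v2|] are at most [r]; so one starts from
    [eps / (2 * r)] ([monotone_of_normal_ineq]).

    From monotone to one-sided: the zero vector is a Clarke normal at every
    point of [Omega], so one of the two normals can be taken to be [0], and the
    monotonicity inequality becomes a one-sided inequality for the other. This
    controls normals of norm at most [1] only, but the Clarke normal cone is
    invariant under positive scaling ([clarke_normalZ]), and the resulting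
    inequality is homogeneous in the normal
    ([normal_ineq_of_monotone]).

    The comparison leaves the pair of points unchanged, so a radius [delta]
    that serves one family of inequalities, for the constants above, serves the
    other, whatever the class of pairs ([monotone_iff_normal_ineq]). Pairs of
    points near [wbar] give part (i), where local closedness comes from
    intersecting [Omega] with a closed ball; pairs with second point [wbar] give
    part (ii). *)

(** * Euclidean inner product and norm *)

Section Euclidean.
Context {R : realType} {n : nat}.
Implicit Types (u v x : 'rV[R]_n) (c : R).

Lemma dotvZl c u v : dotv (c *: u) v = c * dotv u v.
Proof. by rewrite mulr_sumr; apply: eq_bigr => i _; rewrite mxE mulrA. Qed.

Lemma dotvC u v : dotv u v = dotv v u.
Proof. by apply: eq_bigr => i _; rewrite mulrC. Qed.

Lemma dotvNr u v : dotv u (- v) = - dotv u v.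
Proof. by rewrite dotvC -scaleN1r dotvZl mulN1r dotvC. Qed.

Lemma dotvBl u v x : dotv (u - v) x = dotv u x - dotv v x.
Proof.
by rewrite -sumrB; apply: eq_bigr => i _; rewrite !mxE mulrBl.
Qed.

Lemma dot0v u : dotv 0 u = 0.
Proof. by rewrite -(scale0r u) dotvZl mul0r. Qed.

Lemma enorm_ge0 u : 0 <= enorm u.
Proof. exact: sqrtr_ge0. Qed.

Lemma enormZ c u : enorm (c *: u) = `|c| * enorm u.
Proof.
by rewrite /enorm dotvZl dotvC dotvZl mulrA -expr2 sqrtrM ?sqr_ge0// sqrtr_sqr.
Qed.

Lemma enorm0 : enorm (0 : 'rV[R]_n) = 0.
Proof. by rewrite /enorm dot0v sqrtr0. Qed.

Lemma enormBC u v : enorm (u - v) = enorm (v - u).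
Proof. by rewrite -opprB -scaleN1r enormZ normrN1 mul1r. Qed.

Lemma enorm_eq0 u : enorm u = 0 -> u = 0.
Proof.
have sq_ge0 (i : 'I_n) : true -> 0 <= u 0 i * u 0 i.
  by rewrite -expr2 sqr_ge0.
move/eqP; rewrite /enorm sqrtr_eq0 => u_le0.
have /eqP : dotv u u = 0.
  by apply/eqP; rewrite eq_le u_le0; apply: sumr_ge0.
rewrite psumr_eq0// => /allP u0; apply/rowP => i; rewrite mxE.
by have := u0 i (mem_index_enum i); rewrite /= mulf_eq0 orbb => /eqP.
Qed.

(** The topology on row vectors is that of the sup norm, so continuity is read
    off the coordinates. *)
Lemma enorm_continuous : continuous (enorm : 'rV[R]_n -> R).
Proof.
have dot_cont : continuous (fun v : 'rV[R]_n => dotv v v).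
  apply: continuous_big => [|i _ u]; first exact: add_continuous.
  by apply: continuousM; exact: coord_continuous.
by move=> u; apply: continuous_comp (dot_cont u) _; exact: sqrt_continuous.
Qed.

Lemma closed_eball c x : closed (eball c x).
Proof.
have cont : continuous (fun y : 'rV[R]_n => enorm (y - x)).
  move=> y; apply: (@continuous_comp _ _ _ (fun z : 'rV[R]_n => z - x) enorm).
    by apply: (@continuousB _ _ _ id (cst x)) => // z; exact: cst_continuous.
  exact: (enorm_continuous (y - x)).
rewrite /eball -[[set _ | _]]/((fun y => enorm (y - x)) @^-1` [set t | t <= c]).
by apply: preimage_closed => [y _|]; [exact: cont|exact: closed_le].
Qed.

End Euclidean.

(** * Conical structure of the normal cones *)

Section Cones.
Context {R : realType} {n : nat}.
Implicit Types (A Omega : set 'rV[R]_n) (u v w : 'rV[R]_n) (c : R).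

Definition pos_scalable A := forall c v, 0 < c -> A v -> A (c *: v).

(** The vectors sent into the hull of [A] by scaling with [c] form a convex set
    containing [A]. *)
Lemma pos_scalable_convex_hull A :
  pos_scalable A -> pos_scalable (convex_hull A).
Proof.
move=> As c v c0; move: v.
apply: smallest_sub => [x y t|v Av].
  rewrite !inE => xA yA C [Ccvx AC] /=.
  have Cx := xA C (conj Ccvx AC); have Cy := yA C (conj Ccvx AC).
  have := Ccvx (c *: x) (c *: y) t; rewrite !inE => /(_ Cx Cy).
  by rewrite /conv /= scalerDr !scalerA ![c * _]mulrC.
by apply: sub_gen_smallest; exact: As.
Qed.

Lemma pos_scalable_closure A : pos_scalable A -> pos_scalable (closure A).
Proof.
move=> As c v c0 clv B Bcv.
have [a [Aa Ba]] := clv _ (scaler_continuous Bcv).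
by exists (c *: a); split => //; exact: As.
Qed.

Lemma frechet_normalZ Omega w : pos_scalable (frechet_normal Omega w).
Proof.
move=> c v c0 [Ow Nv]; split=> // eps eps0.
have [|d d0 dP] := Nv (eps / c); first exact: divr_gt0.
exists d => // z /dP; rewrite dotvZl -ler_pdivlMl// => /le_trans; apply.
by rewrite mulrA [c^-1 * _]mulrC.
Qed.

Lemma limiting_normalZ Omega w : pos_scalable (limiting_normal Omega w).
Proof.
move=> c v c0 [Ow [wk [vk [Owk wkw Nvk vkv]]]]; split=> //.
exists wk, (fun k => c *: vk k); split=> // [k|].
  exact: frechet_normalZ.
exact: cvgZl_tmp.
Qed.

Lemma clarke_normalZ Omega w : pos_scalable (clarke_normal Omega w).
Proof.
apply: pos_scalable_closure; apply: pos_scalable_convex_hull.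
exact: limiting_normalZ.
Qed.

Lemma clarke_normal0 Omega w : Omega w -> clarke_normal Omega w 0.
Proof.
move=> Ow; apply: subset_closure; apply: sub_gen_smallest.
split=> //; exists (fun=> w), (fun=> 0).
split=> // [|k|]; [exact: cvg_cst| |exact: cvg_cst].
split=> // eps eps0; exists 1 => // z _.
by rewrite dot0v mulr_ge0 ?enorm_ge0// ltW.
Qed.

(** Homogeneity extends a linear bound from the truncation of a cone at radius [1]
    to the whole cone. *)
Lemma le_scale_enorm A x c : pos_scalable A ->
  (forall v, A v -> enorm v <= 1 -> dotv v x <= c) ->
  forall v, A v -> dotv v x <= c * enorm v.
Proof.
move=> As Ac v Av; have [/enorm_eq0 v0|v0] := eqVneq (enorm v) 0.
  by rewrite v0 dot0v enorm0 mulr0.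
have {}v0 : 0 < enorm v by rewrite lt_neqAle eq_sym v0 enorm_ge0.
have := Ac ((enorm v)^-1 *: v); rewrite dotvZl enormZ gtr0_norm ?invr_gt0//.
rewrite mulVf ?gt_eqF// ler_pdivrMl// [_ * c]mulrC; apply=> //.
by apply: As; rewrite ?invr_gt0.
Qed.

End Cones.

(** * Monotonicity versus one-sided normal inequalities *)

Section Pairs.
Context {R : realType} {n : nat}.
Variable Omega : set 'rV[R]_n.
Implicit Types (w : 'rV[R]_n) (r eps : R).

Definition normal_ineq eps w1 w2 := forall v, clarke_normal Omega w1 v ->
  dotv v (w2 - w1) <= eps * enorm v * enorm (w2 - w1).

Definition truncated_monotone r eps w1 w2 :=
  forall v1 v2, truncated_clarke_normal r Omega w1 v1 ->
    truncated_clarke_normal r Omega w2 v2 ->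
    dotv (v1 - v2) (w1 - w2) >= - eps * enorm (w1 - w2).

Lemma monotone_of_normal_ineq r eps w1 w2 : 0 < r -> 0 < eps ->
  normal_ineq (eps / (2 * r)) w1 w2 -> normal_ineq (eps / (2 * r)) w2 w1 ->
  truncated_monotone r eps w1 w2.
Proof.
move=> r0 eps0 N12 N21 v1 v2 [Nv1 v1r] [Nv2 v2r].
have bound (v : 'rV[R]_n) : enorm v <= r ->
    eps / (2 * r) * enorm v * enorm (w1 - w2) <= eps / 2 * enorm (w1 - w2).
  move=> vr; apply: ler_wpM2r; first exact: enorm_ge0.
  rewrite [eps / 2](_ : _ = eps / (2 * r) * r); last by field; rewrite gt_eqF.
  by rewrite ler_pM2l// divr_gt0// mulr_gt0.
move: v1r v2r; rewrite /eball /= !subr0 => v1r v2r.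
have := le_trans (N12 _ Nv1); rewrite enormBC => /(_ _ (bound v1 v1r)).
have := le_trans (N21 _ Nv2) (bound v2 v2r).
by rewrite -[w2 - w1]opprB dotvNr dotvBl; lra.
Qed.

Lemma normal_ineq_of_monotone eps w1 w2 : Omega w1 -> Omega w2 ->
  truncated_monotone 1 eps w1 w2 ->
  normal_ineq eps w1 w2 /\ normal_ineq eps w2 w1.
Proof.
have trunc0 w : Omega w -> truncated_clarke_normal 1 Omega w 0.
  by move=> Ow; split; [exact: clarke_normal0|rewrite /eball /= subr0 enorm0].
move=> wO1 wO2 mono; split=> v Nv; rewrite mulrAC.
all: apply: le_scale_enorm Nv; first exact: clarke_normalZ.
all: move=> {}v Nv v1.
  have := mono v 0 _ (trunc0 _ wO2); rewrite subr0 (enormBC w1) -[w1 - w2]opprB.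
  by rewrite dotvNr mulNr lerN2; apply; split; rewrite /eball /= ?subr0.
have := mono 0 v (trunc0 _ wO1).
rewrite sub0r -(scaleN1r v) dotvZl mulN1r mulNr lerN2.
by apply; split; rewrite /eball /= ?subr0.
Qed.

(** The class [P delta] of pairs is a parameter so that subsmoothness and
    semi-subsmoothness are both instances. *)
Lemma monotone_iff_normal_ineq (P : R -> 'rV[R]_n -> 'rV[R]_n -> Prop) :
  (forall delta w1 w2, P delta w1 w2 -> Omega w1 /\ Omega w2) ->
  (forall r eps, 0 < r -> 0 < eps -> exists2 delta : R, 0 < delta &
     forall w1 w2, P delta w1 w2 -> truncated_monotone r eps w1 w2) <->
  (forall eps, 0 < eps -> exists2 delta : R, 0 < delta &
     forall w1 w2, P delta w1 w2 ->
       normal_ineq eps w1 w2 /\ normal_ineq eps w2 w1).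
Proof.
move=> PO; split=> [mono eps eps0|ineq r eps r0 eps0].
  have [delta d0 dP] := mono 1 eps ltr01 eps0; exists delta => // w1 w2 Pw.
  by have [wO1 wO2] := PO _ _ _ Pw; apply: normal_ineq_of_monotone; last exact: dP.
have [|delta d0 dP] := ineq (eps / (2 * r)).
  by rewrite divr_gt0// mulr_gt0.
exists delta => // w1 w2 /dP[N12 N21].
exact: monotone_of_normal_ineq.
Qed.

End Pairs.

Theorem theorem3p4 (R : realType) (n : nat) (Omega : set 'rV[R]_n)
    (wbar : 'rV[R]_n) (Omega_closed : closed Omega)
    (Omega_nonempty : Omega !=set0) (Omega_wbar : Omega wbar) :
  (subsmooth Omega wbar <-> clarke_super_regular Omega wbar) /\
  (semi_subsmooth Omega wbar <->
    forall eps : R, 0 < eps -> exists2 delta : R, 0 < delta &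
      (forall vbar, clarke_normal Omega wbar vbar ->
        forall w, (Omega `&` eball delta wbar) w ->
          dotv vbar (w - wbar) <= eps * enorm vbar * enorm (w - wbar)) /\
      (forall w, (Omega `&` eball delta wbar) w ->
        forall v, clarke_normal Omega w v ->
          dotv v (wbar - w) <= eps * enorm v * enorm (wbar - w))).
Proof.
split.
  have [] := monotone_iff_normal_ineq Omega (fun delta w1 w2 =>
    (eball delta wbar `&` Omega) w1 /\ (eball delta wbar `&` Omega) w2).
    by move=> delta w1 w2 [[_ ?] [_ ?]].
  move=> to_ineq to_mono; split=> [[_ _ mono]|[_ _ ineq]]; split=> //.
  - by exists 1 => //; apply: closedI => //; exact: closed_eball.
  - move=> eps eps0; have [|delta d0 dP] := to_ineq _ eps eps0.
      move=> r e r0 e0; have [delta d0 dP] := mono r e r0 e0.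
      by exists delta => // w1 w2 [W1 W2]; exact: dP.
    exists delta => // w1 v1 [wO1 B1] Nv1 w2 [wO2 B2].
    by have [N12 _] := dP w1 w2 (conj (conj B1 wO1) (conj B2 wO2)); exact: N12.
  - move=> r eps r0 eps0; have [|delta d0 dP] := to_mono _ r eps r0 eps0.
    + move=> e e0; have [delta d0 dP] := ineq e e0; exists delta => //.
      move=> w1 w2 [[B1 wO1] [B2 wO2]].
      by split=> v Nv; apply: dP Nv _ _; split.
    + by exists delta => // w1 w2 W1 W2; exact: dP.
have [] := monotone_iff_normal_ineq Omega (fun delta w1 w2 =>
  (eball delta wbar `&` Omega) w1 /\ w2 = wbar).
  by move=> delta w1 w2 [[_ ?] ->].
move=> to_ineq to_mono; split=> [[_ _ mono]|ineq].
  move=> eps eps0; have [|delta d0 dP] := to_ineq _ eps eps0.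
    move=> r e r0 e0; have [delta d0 dP] := mono r e r0 e0.
    by exists delta => // w1 w2 [W1 ->]; exact: dP.
  exists delta => //; split=> [v Nv w [Ow Bw]|w [Ow Bw] v Nv].
    by have [_ N] := dP w wbar (conj (conj Bw Ow) erefl); exact: N.
  by have [N _] := dP w wbar (conj (conj Bw Ow) erefl); exact: N.
split=> // r eps r0 eps0; have [|delta d0 dP] := to_mono _ r eps r0 eps0.
  move=> e e0; have [delta d0 [dP1 dP2]] := ineq e e0; exists delta => //.
  move=> w1 w2 [[B1 wO1] ->]; split=> v Nv; first exact: dP2.
  exact: dP1.
by exists delta => // w1 W1; exact: dP.
Qed.
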